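(* Let $n\ge 1$ and let $A,B\subseteq[1;n]$ with $B\subseteq A$. Then $\Lambda_A$ and $\Lambda_B$ commute in $U_q(\mathfrak{sl}_2)^{\otimes n}$: $\Lambda_A\Lambda_B=\Lambda_B\Lambda_A$.
   Context: Let $\mathbb{K}$ be a field and $q\in\mathbb{K}$ not a root of unity. $U_q(\mathfrak{sl}_2)$ is the associative $\mathbb{K}$-algebra with generators $E,F,K,K^{-1}$ and relations $KK^{-1}=K^{-1}K=1$, $KE=q^2EK$, $KF=q^{-2}FK$, $EF-FE=\frac{K-K^{-1}}{q-q^{-1}}$. Its Casimir element is $\Lambda=(q-q^{-1})^2EF+q^{-1}K+qK^{-1}$. The coproduct is the algebra morphism $\Delta:U_q(\mathfrak{sl}_2)\to U_q(\mathfrak{sl}_2)^{\otimes2}$ with $\Delta(E)=E\otimes1+K\otimes E$, $\Delta(F)=F\otimes K^{-1}+1\otimes F$, $\Delta(K^{\pm1})=K^{\pm1}\otimes K^{\pm1}$. Let $\mathcal{I}_R$ be the subalgebra generated by $EK^{-1},F,K^{-1},\Lambda$, and $\tau_R:\mathcal{I}_R\to U_q(\mathfrak{sl}_2)\otimes\mathcal{I}_R$ the algebra morphism with $\tau_R(EK^{-1})=K^{-1}\otimes EK^{-1}$, $\tau_R(F)=K\otimes F-q^{-3}(q-q^{-1})^2F^2K\otimes EK^{-1}+q^{-1}(q+q^{-1})FK\otimes K^{-1}-q^{-1}FK\otimes\Lambda$, $\tau_R(K^{-1})=1\otimes K^{-1}-q^{-1}(q-q^{-1})^2F\otimes EK^{-1}$,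 $\tau_R(\Lambda)=1\otimes\Lambda$. For integers $i\le j$, $[i;j]=\{i,i+1,\dots,j\}$. For a map $\varphi$ and $\ell,m\ge0$, $1^{\otimes\ell}\otimes\varphi\otimes1^{\otimes m}$ applies $\varphi$ to tensor position $\ell+1$ and the identity elsewhere. Define $\Lambda_\varnothing=q+q^{-1}$ (a scalar), and for $A=\{a_1<\dots<a_m\}\subseteq[1;n]$ define $\Lambda_A=1^{\otimes(a_1-1)}\otimes(\mu_m\circ\cdots\circ\mu_2)(\Lambda)\otimes1^{\otimes(n-a_m)}\in U_q(\mathfrak{sl}_2)^{\otimes n}$, where $\mu_i=(1^{\otimes(a_i-a_1-1)}\otimes\tau_R)\circ\cdots\circ(1^{\otimes(a_{i-1}-a_1+1)}\otimes\tau_R)\circ(1^{\otimes(a_{i-1}-a_1)}\otimes\Delta)$ (the $\tau_R$ factors being absent when $a_i=a_{i-1}+1$); these compositions are well defined. In particular $\Lambda_{\{i\}}=1^{\otimes(i-1)}\otimes\Lambda\otimes1^{\otimes(n-i)}$. *)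

(* Defs.v *)
From mathcomp Require Import all_boot all_order all_algebra.
Set Implicit Arguments. Unset Strict Implicit. Unset Printing Implicit Defensive.
Import GRing.Theory.
Local Open Scope ring_scope.

Inductive term (K : Type) (V : Type) : Type :=
| tVar of V
| tCst of K
| tAdd of term K V & term K V
| tMul of term K V & term K V.
Arguments tVar {K V}. Arguments tCst {K V}.
Arguments tAdd {K V}. Arguments tMul {K V}.

Fixpoint tbind (K V W : Type) (f : V -> term K W) (t : term K V) : term K W :=
  match t with
  | tVar v => f v
  | tCst c => tCst c
  | tAdd a b => tAdd (tbind f a) (tbind f b)
  | tMul a b => tMul (tbind f a) (tbind f b)
  end.

Section Syntax.
Variables (K : fieldType) (V : Type).
Definition tSc (c : K) (t : term K V) : term K V := tMul (tCst c) t.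
Definition tSub (a b : term K V) : term K V := tAdd a (tSc (-1) b).
Definition tOne : term K V := tCst 1.
End Syntax.

Inductive gen := gE | gF | gK | gKi.

(* Generators EK^{-1}, F, K^{-1}, Lambda of the subalgebra I_R. *)
Inductive igen := iX (* E K^{-1} *) | iF (* F *) | iY (* K^{-1} *) | iL (* Lambda *).

(* U_q(sl_2)^{(x) n}, presented by generators E_i, F_i, K_i, K_i^{-1}       *)
(* (i : 'I_n, the i-th tensor factor) and relations: those of U_q(sl_2) in   *)
(* each factor, and commutation of generators in different factors.          *)
(* ueq K q n t u  <->  t and u denote the same element of U_q(sl_2)^{(x) n}.  *)
(* It is the least congruence containing the K-algebra axioms and the       *)
(* defining relations, i.e. the presented algebra.                           *)
Definition ulet (n : nat) := ('I_n * gen)%type.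

Inductive ueq (K : fieldType) (q : K) (n : nat) :
  term K (ulet n) -> term K (ulet n) -> Prop :=
| ueq_refl t : ueq q t t
| ueq_sym t u : ueq q t u -> ueq q u t
| ueq_trans t u v : ueq q t u -> ueq q u v -> ueq q t v
| ueq_add t t' u u' : ueq q t t' -> ueq q u u' -> ueq q (tAdd t u) (tAdd t' u')
| ueq_mul t t' u u' : ueq q t t' -> ueq q u u' -> ueq q (tMul t u) (tMul t' u')
| ueq_addA t u v : ueq q (tAdd t (tAdd u v)) (tAdd (tAdd t u) v)
| ueq_addC t u : ueq q (tAdd t u) (tAdd u t)
| ueq_add0 t : ueq q (tAdd (tCst 0) t) t
| ueq_addN t : ueq q (tAdd t (tMul (tCst (-1)) t)) (tCst 0)
| ueq_mulA t u v : ueq q (tMul t (tMul u v)) (tMul (tMul t u) v)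
| ueq_mul1l t : ueq q (tMul (tCst 1) t) t
| ueq_mul1r t : ueq q (tMul t (tCst 1)) t
| ueq_mul0l t : ueq q (tMul (tCst 0) t) (tCst 0)
| ueq_mulDl t u v : ueq q (tMul (tAdd t u) v) (tAdd (tMul t v) (tMul u v))
| ueq_mulDr t u v : ueq q (tMul t (tAdd u v)) (tAdd (tMul t u) (tMul t v))
| ueq_cstD (a b : K) : ueq q (tCst (a + b)) (tAdd (tCst a) (tCst b))
| ueq_cstM (a b : K) : ueq q (tCst (a * b)) (tMul (tCst a) (tCst b))
| ueq_cstC (a : K) t : ueq q (tMul (tCst a) t) (tMul t (tCst a))
| ueq_KKi (i : 'I_n) : ueq q (tMul (tVar (i, gK)) (tVar (i, gKi))) (tCst 1)
| ueq_KiK (i : 'I_n) : ueq q (tMul (tVar (i, gKi)) (tVar (i, gK))) (tCst 1)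
| ueq_KE (i : 'I_n) : ueq q (tMul (tVar (i, gK)) (tVar (i, gE)))
                          (tSc (q ^+ 2) (tMul (tVar (i, gE)) (tVar (i, gK))))
| ueq_KF (i : 'I_n) : ueq q (tMul (tVar (i, gK)) (tVar (i, gF)))
                          (tSc (q ^- 2) (tMul (tVar (i, gF)) (tVar (i, gK))))
| ueq_EF (i : 'I_n) :
    ueq q (tSub (tMul (tVar (i, gE)) (tVar (i, gF))) (tMul (tVar (i, gF)) (tVar (i, gE))))
          (tSc (q - q^-1)^-1 (tSub (tVar (i, gK)) (tVar (i, gKi))))
| ueq_comm (i j : 'I_n) (g h : gen) : i != j ->
    ueq q (tMul (tVar (i, g)) (tVar (j, h))) (tMul (tVar (j, h)) (tVar (i, g))).

(* Intermediate elements live in U^{(x) p} (x) I_R: they are written with    *)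
(* letters inl (j, g) (generator g of U in factor j < p) and inr (p, h)      *)
(* (generator h of I_R in the last factor p).                                *)
Section Lambda.
Variables (K : fieldType) (q : K).

Definition mlet := ((nat * gen) + (nat * igen))%type.
Definition U_ (j : nat) (g : gen) : term K mlet := tVar (inl (j, g)).
Definition I_ (j : nat) (h : igen) : term K mlet := tVar (inr (j, h)).

Definition casimir (V : Type) (u : gen -> term K V) : term K V :=
  tAdd (tAdd (tSc ((q - q^-1) ^+ 2) (tMul (u gE) (u gF))) (tSc q^-1 (u gK)))
       (tSc q (u gKi)).

(* The coproduct restricted to I_R, with values in U (x) I_R, on the          *)
(* generators of I_R sitting in factor p; result uses factors p, p+1.        *)
(* (these are Delta(E)Delta(K^-1), Delta(F), Delta(K^-1) and                  *)
(*  (q-q^-1)^2 Delta(E)Delta(F) + q^-1 Delta(K) + q Delta(K^-1) regrouped).   *)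
Definition deltaI (p : nat) (h : igen) : term K mlet :=
  match h with
  | iX => tAdd (tMul (tMul (U_ p gE) (U_ p gKi)) (I_ p.+1 iY)) (I_ p.+1 iX)
  | iF => tAdd (tMul (U_ p gF) (I_ p.+1 iY)) (I_ p.+1 iF)
  | iY => tMul (U_ p gKi) (I_ p.+1 iY)
  | iL =>
    tAdd (tAdd (tAdd
      (tSc ((q - q^-1) ^+ 2)
        (tAdd (tAdd (tMul (tMul (U_ p gE) (U_ p gF)) (I_ p.+1 iY))
                    (tMul (U_ p gE) (I_ p.+1 iF)))
              (tMul (tMul (U_ p gK) (U_ p gF)) (I_ p.+1 iX))))
      (tMul (U_ p gK) (I_ p.+1 iL)))
      (tSc (- q) (tMul (U_ p gK) (I_ p.+1 iY))))
      (tSc q (tMul (U_ p gKi) (I_ p.+1 iY)))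
  end.

Definition tauI (p : nat) (h : igen) : term K mlet :=
  match h with
  | iX => tMul (U_ p gKi) (I_ p.+1 iX)
  | iF =>
    tAdd (tAdd (tAdd
      (tMul (U_ p gK) (I_ p.+1 iF))
      (tSc (- (q ^- 3 * (q - q^-1) ^+ 2))
           (tMul (tMul (tMul (U_ p gF) (U_ p gF)) (U_ p gK)) (I_ p.+1 iX))))
      (tSc (q^-1 * (q + q^-1)) (tMul (tMul (U_ p gF) (U_ p gK)) (I_ p.+1 iY))))
      (tSc (- q^-1) (tMul (tMul (U_ p gF) (U_ p gK)) (I_ p.+1 iL)))
  | iY => tSub (I_ p.+1 iY)
               (tSc (q^-1 * (q - q^-1) ^+ 2) (tMul (U_ p gF) (I_ p.+1 iX)))
  | iL => I_ p.+1 iL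
  end.

Definition on_last (phi : nat -> igen -> term K mlet) (p : nat)
  (t : term K mlet) : term K mlet :=
  tbind (fun l => match l with
                  | inl (j, g) => U_ j g
                  | inr (j, h) => if j == p then phi p h else I_ j h
                  end) t.

Fixpoint taus (k p : nat) (t : term K mlet) : term K mlet :=
  match k with
  | 0 => t
  | k'.+1 => taus k' p.+1 (on_last tauI p t)
  end.

(* mu_m o ... o mu_2 ; p = a_{i-1} - a_1 is the index of the last factor,    *)
(* prev = a_{i-1}, rest = a_i, ..., a_m (all 0-based).                       *)
Fixpoint mus (p prev : nat) (rest : seq nat) (t : term K mlet) : term K mlet :=
  match rest with
  | [::] => t
  | a :: rest' =>
      mus (p + (a - prev)) a rest' (taus (a - prev - 1) p.+1 (on_last deltaI p t))
  end.

Definition uvar (n j : nat) (g : gen) : term K (ulet n) :=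
  match (insub j : option 'I_n) with
  | Some i => tVar (i, g)
  | None => tCst 0 (* never used for A included in [1;n] *)
  end.

Definition interpI (n j : nat) (h : igen) : term K (ulet n) :=
  match h with
  | iX => tMul (uvar n j gE) (uvar n j gKi)
  | iF => uvar n j gF
  | iY => uvar n j gKi
  | iL => casimir (uvar n j)
  end.

Definition embed (n a1 : nat) (t : term K mlet) : term K (ulet n) :=
  tbind (fun l => match l with
                  | inl (j, g) => uvar n (a1 + j) g
                  | inr (j, h) => interpI n (a1 + j) h
                  end) t.

(* Lambda_A for A a subset of [1;n], here encoded as a subset of 'I_n        *)
(* (element i : 'I_n standing for i+1).                                      *)
Definition LambdaA (n : nat) (A : {set 'I_n}) : term K (ulet n) :=
  match sort leq [seq nat_of_ord i | i <- enum A] with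
  | [::] => tCst (q + q^-1)
  | a1 :: rest => embed n a1 (mus 0 a1 rest (I_ 0 iL))
  end.

End Lambda.

(* Main.v *)
(* Delta and tau_R map the span of the four generators X = E K^{-1}, F,       *)
(* Y = K^{-1}, Lambda of I_R into U (x) span, so Lambda_A is an entry of a    *)
(* product of 4 x 4 transfer matrices, one for each factor, with entries in   *)
(* that factor: Delta's matrix at the positions in A, tau_R's at the others.  *)
(* Let W_j, W'_j be the 4-vectors obtained for A and for B by multiplying out *)
(* the factors from position j on. A constant 16 x 16 matrix S intertwines    *)
(* them:                                                                      *)
(*       W'_j(b) W_j(a) = sum_{c,d} S^{ab}_{cd} W_j(c) W'_j(d),               *)
(* by downward induction on j from max B: S satisfies an RTT relation with    *)
(* each of the pairs (Delta, Delta), (Delta, tau_R), (tau_R, tau_R), which    *)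
(* are the pairs allowed by B being included in A. As the row of S at         *)
(* (Lambda, Lambda) is trivial, Lambda_A and Lambda_B commute. These finitely *)
(* many relations in U_q(sl_2) are verified by computing normal forms.        *)
Require Import Defs.
From HB Require Import structures.
From mathcomp Require Import all_boot all_order all_algebra.
From mathcomp Require Import ring zify boolp.
Set Implicit Arguments. Unset Strict Implicit. Unset Printing Implicit Defensive.
Import GRing.Theory.
Local Open Scope ring_scope.
Local Open Scope quotient_scope.


(** Both elements are computed in the ring [Uq] of classes of terms modulo [ueq]. Reading the
    iterated compositions from the right turns Lambda_A into the Lambda-entry of a vector W_0, where
    W_j is obtained from W_{j+1} by a matrix with entries in factor j ([chain], [pi_LambdaA]). The
    entries of W_{j+1} and W'_{j+1} commute with factor j, so an exchange relation between these
    vectors passes to W_j and W'_j as soon as the two matrices at j satisfy the RTT relation for S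
    ([exch_step]). At max B it holds directly ([exch_base], [exch_step_base]). Hence it reaches j =
    0 ([chain_exch]), where its (Lambda, Lambda) component is the commutation
    ([chain_casimir_comm]). The local relations are proved by reflection: [check] compares ordered
    normal forms, and [checkP] turns a successful check into an identity under every valuation that
    satisfies the rewriting rules. *)

HB.instance Definition _ (K V : Type) := gen_eqMixin (term K V).
HB.instance Definition _ (K V : Type) := gen_choiceMixin (term K V).

(** * The ring presented by ueq *)

Section Quotient.
Variables (K : fieldType) (q : K) (n : nat).

Definition ueqb (t u : term K (ulet n)) : bool := `[< ueq q t u >].

Lemma ueqb_equiv : equiv_class_of ueqb.
Proof.
split=> [t|t u|u t v].
- by apply/asboolP; apply: ueq_refl.
- by apply/asboolP/asboolP; apply: ueq_sym.
- move=> /asboolP tu /asboolP uv; apply/asboolP; exact: ueq_trans tu uv.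
Qed.

Canonical ueqb_equivRel := EquivRelPack ueqb_equiv.

Definition Uq := {eq_quot ueqb}.
HB.instance Definition _ := Choice.on Uq.
HB.instance Definition _ := EqQuotient.on Uq.

Lemma piP (t u : term K (ulet n)) : ueq q t u <-> \pi_Uq t = \pi_Uq u.
Proof.
split=> [tu|/eqquotP/asboolP //].
by apply/eqquotP/asboolP.
Qed.

Definition Uq_add (x y : Uq) : Uq := \pi_Uq (tAdd (repr x) (repr y)).
Definition Uq_mul (x y : Uq) : Uq := \pi_Uq (tMul (repr x) (repr y)).
Definition Uq_opp (x : Uq) : Uq := \pi_Uq (tMul (tCst (-1)) (repr x)).
Definition Uq_cst (c : K) : Uq := \pi_Uq (tCst c).

Lemma ueq_repr t : ueq q (repr (\pi_Uq t)) t.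
Proof. by apply/piP; rewrite reprK. Qed.

Lemma pi_add t u : \pi_Uq (tAdd t u) = Uq_add (\pi_Uq t) (\pi_Uq u).
Proof. by apply/piP; apply: ueq_add; apply/ueq_sym/ueq_repr. Qed.
Lemma pi_mul t u : \pi_Uq (tMul t u) = Uq_mul (\pi_Uq t) (\pi_Uq u).
Proof. by apply/piP; apply: ueq_mul; apply/ueq_sym/ueq_repr. Qed.
Lemma pi_opp t : \pi_Uq (tMul (tCst (-1)) t) = Uq_opp (\pi_Uq t).
Proof. by apply/piP; apply: ueq_mul; [exact: ueq_refl|apply/ueq_sym/ueq_repr]. Qed.

Lemma Uq_addA : associative Uq_add.
Proof.
elim/quotW=> t; elim/quotW=> u; elim/quotW=> v.
by rewrite -(pi_add u v) -(pi_add t u) -!pi_add; apply/piP; apply: ueq_addA.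
Qed.
Lemma Uq_addC : commutative Uq_add.
Proof.
by elim/quotW=> t; elim/quotW=> u; rewrite -!pi_add; apply/piP; apply: ueq_addC.
Qed.
Lemma Uq_add0 : left_id (Uq_cst 0) Uq_add.
Proof. by elim/quotW=> t; rewrite -pi_add; apply/piP; apply: ueq_add0. Qed.
Lemma Uq_addN : left_inverse (Uq_cst 0) Uq_opp Uq_add.
Proof.
by elim/quotW=> t; rewrite Uq_addC -pi_opp -pi_add; apply/piP; apply: ueq_addN.
Qed.
HB.instance Definition _ := GRing.isZmodule.Build Uq Uq_addA Uq_addC Uq_add0 Uq_addN.

Lemma Uq_mulA : associative Uq_mul.
Proof.
elim/quotW=> t; elim/quotW=> u; elim/quotW=> v.
by rewrite -(pi_mul u v) -(pi_mul t u) -!pi_mul; apply/piP; apply: ueq_mulA.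
Qed.
Lemma Uq_mul1l : left_id (Uq_cst 1) Uq_mul.
Proof. by elim/quotW=> t; rewrite -pi_mul; apply/piP; apply: ueq_mul1l. Qed.
Lemma Uq_mul1r : right_id (Uq_cst 1) Uq_mul.
Proof. by elim/quotW=> t; rewrite -pi_mul; apply/piP; apply: ueq_mul1r. Qed.
Lemma Uq_mulDl : left_distributive Uq_mul Uq_add.
Proof.
elim/quotW=> t; elim/quotW=> u; elim/quotW=> v.
by rewrite -(pi_add t u) -(pi_mul t v) -(pi_mul u v) -pi_mul -pi_add;
   apply/piP; apply: ueq_mulDl.
Qed.
Lemma Uq_mulDr : right_distributive Uq_mul Uq_add.
Proof.
elim/quotW=> t; elim/quotW=> u; elim/quotW=> v.
by rewrite -(pi_add u v) -(pi_mul t u) -(pi_mul t v) -pi_mul -pi_add;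
   apply/piP; apply: ueq_mulDr.
Qed.
HB.instance Definition _ := GRing.Zmodule_isPzRing.Build Uq
  Uq_mulA Uq_mul1l Uq_mul1r Uq_mulDl Uq_mulDr.

Lemma Uq_cst_is_zmod_morphism : zmod_morphism Uq_cst.
Proof.
move=> a b; apply: (canRL (addrK _)).
by rewrite -[RHS]/(Uq_cst a); rewrite -[LHS]pi_add;
   apply/piP; rewrite -{2}[a](subrK b); apply/ueq_sym/ueq_cstD.
Qed.
Lemma Uq_cst_is_monoid_morphism : monoid_morphism Uq_cst.
Proof.
split=> // a b; rewrite -[RHS]pi_mul; apply/piP; apply: ueq_cstM.
Qed.
HB.instance Definition _ := GRing.isZmodMorphism.Build K Uq Uq_cst Uq_cst_is_zmod_morphism.
HB.instance Definition _ := GRing.isMonoidMorphism.Build K Uq Uq_cst Uq_cst_is_monoid_morphism.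

(** The K-algebra structure is carried by the ring morphism [Uq_cst] together with the centrality of
    its image. *)
Lemma Uq_cstC a (x : Uq) : Uq_cst a * x = x * Uq_cst a.
Proof.
by elim/quotW: x => t; rewrite -[LHS]pi_mul -[RHS]pi_mul; apply/piP; apply: ueq_cstC.
Qed.

End Quotient.

(** * Evaluation of terms in a ring *)

Section Evaluation.
Variables (C : Type) (R : pzRingType) (iota : C -> R).

(** The constants have a type of their own: K for the terms of the statement, integer Laurent
    polynomials for those handled by [check]. *)
Fixpoint teval (V : Type) (f : V -> R) (t : term C V) : R :=
  match t with
  | tVar v => f v
  | tCst c => iota c
  | tAdd a b => teval f a + teval f b
  | tMul a b => teval f a * teval f b
  end.

Lemma teval_tbind (V W : Type) (f : W -> R) (s : V -> term C W) t :
  teval f (tbind s t) = teval (fun v => teval f (s v)) t.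
Proof. by elim: t => //= a -> b ->. Qed.

Lemma eq_teval (V : Type) (f g : V -> R) t : f =1 g -> teval f t = teval g t.
Proof. by move=> fg; elim: t => //= a -> b ->. Qed.
End Evaluation.

(** * Exchange relations, by computation of normal forms *)

(* lE stands for (q - q^-1)^2 E and lW iX for (q - q^-1)^2 times the X-entry   *)
(* of W (similarly lW'): this rescaling leaves only integer Laurent            *)
(* polynomials in q as coefficients.                                           *)
Inductive letter := lF | lK | lKi | lE | lW of igen | lW' of igen.

Definition igen_code (h : igen) : nat :=
  match h with iX => 0 | iF => 1 | iY => 2 | iL => 3 end.
Definition igen_decode (k : nat) : igen :=
  match k with 0 => iX | 1 => iF | 2 => iY | _ => iL end.
Definition letter_code (l : letter) : nat :=
  match l with
  | lF => 0 | lK => 1 | lKi => 2 | lE => 3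
  | lW h => (4 + igen_code h)%N | lW' h => (8 + igen_code h)%N
  end.
Definition letter_decode (k : nat) : letter :=
  match k with
  | 0 => lF | 1 => lK | 2 => lKi | 3 => lE
  | k'.+4 => if (k' < 4)%N then lW (igen_decode k') else lW' (igen_decode (k' - 4))
  end.
Lemma letter_codeK : cancel letter_code letter_decode.
Proof. by case=> // -[]. Qed.
HB.instance Definition _ := Equality.copy letter (can_type letter_codeK).

Definition igens : seq igen := [:: iX; iF; iY; iL].

(* (c, d) stands for the Laurent monomial c q^d, and (c, d, w) for c q^d w. *)
Definition mono := (int * int * seq letter)%type.

(* The rows of the matrix S of the header: it is the unique solution of the    *)
(* linear system formed by the five relations checked below.                   *)
Definition exch (i j : igen) : seq (int * int * (igen * igen)) :=
  match i, j with
  | iX, iX => [:: (1, 0, (iX, iX))]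
  | iX, iF => [:: (1, 0, (iX, iF)); (-1, -1, (iY, iY)); (1, Posz 3, (iY, iY));
                  (1, 0, (iY, iL)); (-1, Posz 2, (iY, iL))]
  | iX, iY => [:: (1, 0, (iX, iY)); (1, 0, (iY, iX)); (-1, Posz 2, (iY, iX))]
  | iX, iL => [:: (1, 0, (iX, iL))]
  | iF, iX => [:: (1, 0, (iF, iX)); (1, -1, (iY, iY)); (-1, Posz 3, (iY, iY));
                  (-1, 0, (iY, iL)); (1, Posz 2, (iY, iL))]
  | iF, iF => [:: (1, 0, (iF, iF))]
  | iF, iY => [:: (1, 0, (iF, iY)); (-1, -2, (iY, iF)); (1, 0, (iY, iF))]
  | iF, iL => [:: (1, 0, (iF, iL))]
  | iY, iX => [:: (1, Posz 2, (iY, iX))]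
  | iY, iF => [:: (1, -2, (iY, iF))]
  | iY, iY => [:: (1, 0, (iY, iY))]
  | iY, iL => [:: (1, 0, (iY, iL))]
  | iL, iX => [:: (1, -3, (iX, iY)); (-1, 1, (iX, iY));
                  (-1, -2, (iX, iL)); (1, 0, (iX, iL));
                  (-1, -1, (iY, iX)); (1, Posz 3, (iY, iX)); (1, -2, (iL, iX))]
  | iL, iF => [:: (-1, -1, (iF, iY)); (1, Posz 3, (iF, iY));
                  (1, 0, (iF, iL)); (-1, Posz 2, (iF, iL));
                  (1, -3, (iY, iF)); (-1, 1, (iY, iF)); (1, Posz 2, (iL, iF))]
  | iL, iY => [:: (-1, -2, (iX, iF)); (1, 0, (iX, iF));
                  (1, -2, (iF, iX)); (-1, 0, (iF, iX));
                  (1, -3, (iY, iY)); (-1, -1, (iY, iY));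
                  (-1, 1, (iY, iY)); (1, Posz 3, (iY, iY));
                  (-1, -2, (iY, iL)); (Posz 2, 0, (iY, iL)); (-1, Posz 2, (iY, iL));
                  (1, 0, (iL, iY))]
  | iL, iL => [:: (1, 0, (iL, iL))]
  end.

(** Oriented towards words in the order F, K or K^-1, E, W, W'. The rule for W' W is the exchange
    relation at the next factor, that is, the induction hypothesis. *)
Definition rule (l x : letter) : option (seq mono) :=
  match l, x with
  | lE, lF => Some [:: (1, 0, [:: lF; lE]); (1, 1, [:: lK]); (-1, -1, [:: lK]);
                       (-1, 1, [:: lKi]); (1, -1, [:: lKi])]
  | lK, lF => Some [:: (1, -2, [:: lF; lK])]
  | lKi, lF => Some [:: (1, Posz 2, [:: lF; lKi])]
  | lE, lK => Some [:: (1, -2, [:: lK; lE])]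
  | lE, lKi => Some [:: (1, Posz 2, [:: lKi; lE])]
  | lK, lKi | lKi, lK => Some [:: (1, 0, [::])]
  | lW' j, lW i => Some [seq (m.1, [:: lW m.2.1; lW' m.2.2]) | m <- exch i j]
  | (lW _ | lW' _), (lF | lK | lKi | lE) => Some [:: (1, 0, [:: x; l])]
  | _, _ => None
  end.

Definition scale (c : int * int) (p : seq mono) : seq mono :=
  [seq (c.1 * m.1.1, c.2 + m.1.2, m.2) | m <- p].

Definition bindp (f : seq letter -> seq mono) (p : seq mono) : seq mono :=
  flatten [seq scale m.1 (f m.2) | m <- p].

(* Normal form of l w, for w normal; running out of fuel only affects           *)
(* normality, never correctness.                                               *)
Fixpoint push (fuel : nat) (l : letter) (w : seq letter) : seq mono :=
  if fuel is fuel'.+1 then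
    if w is x :: w' then
      if rule l x is Some p
      then bindp (foldr (fun y => bindp (push fuel' y)) [:: (1, 0, w')]) p
      else [:: (1, 0, l :: w)]
    else [:: (1, 0, [:: l])]
  else [:: (1, 0, l :: w)].

Definition laurent := seq (int * int).
Definition sterm := term laurent letter.

Fixpoint act (t : sterm) (p : seq mono) : seq mono :=
  match t with
  | tVar l => bindp (push 20 l) p
  | tCst c => flatten [seq scale x p | x <- c]
  | tAdd a b => act a p ++ act b p
  | tMul a b => act a (act b p)
  end.

Fixpoint insert (m : mono) (p : seq mono) : seq mono :=
  if p is m' :: p' then
    if (m.1.2 == m'.1.2) && (m.2 == m'.2)
    then (m.1.1 + m'.1.1, m.1.2, m.2) :: p'
    else m' :: insert m p'
  else [:: m].

Definition check (t u : sterm) : bool :=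
  all (fun m => m.1.1 == 0)
    (foldr insert [::] (act t [:: (1, 0, [::])] ++ scale (-1, 0) (act u [:: (1, 0, [::])]))).

Definition tmono (c d : int) : sterm := tCst [:: (c, d)].

Definition exchT (w w' : igen -> sterm) (i j : igen) : sterm :=
  foldr tAdd (tCst [::])
    [seq tMul (tmono m.1.1 m.1.2) (tMul (w m.2.1) (w' m.2.2)) | m <- exch i j].

Definition check_exch (w w' : igen -> sterm) : bool :=
  all (fun i => all (fun j => check (tMul (w' j) (w i)) (exchT w w' i j)) igens) igens.

Definition vterm (h : igen) : sterm :=
  match h with
  | iX => tMul (tVar lE) (tVar lKi)
  | iF => tVar lF
  | iY => tVar lKi
  | iL => tAdd (tAdd (tMul (tVar lE) (tVar lF)) (tMul (tmono 1 (-1)) (tVar lK)))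
               (tMul (tmono 1 1) (tVar lKi))
  end.

Definition Dterm (w : igen -> letter) (h : igen) : sterm :=
  let w h := tVar (w h) in
  match h with
  | iX => tAdd (tMul (tMul (tVar lE) (tVar lKi)) (w iY)) (w iX)
  | iF => tAdd (tMul (tVar lF) (w iY)) (w iF)
  | iY => tMul (tVar lKi) (w iY)
  | iL => tAdd (tAdd (tAdd (tAdd (tAdd
      (tMul (tMul (tVar lE) (tVar lF)) (w iY)) (tMul (tVar lE) (w iF)))
      (tMul (tMul (tVar lK) (tVar lF)) (w iX))) (tMul (tVar lK) (w iL)))
      (tMul (tmono (-1) 1) (tMul (tVar lK) (w iY))))
      (tMul (tmono 1 1) (tMul (tVar lKi) (w iY)))
  end.

(** In [tauI] the factor (q - q^-1)^2 always multiplies X, so the rescaling absorbs it; moreover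
    q^-1 (q + q^-1) = 1 + q^-2. *)
Definition Tterm (w : igen -> letter) (h : igen) : sterm :=
  let w h := tVar (w h) in
  let FK := tMul (tVar lF) (tVar lK) in
  match h with
  | iX => tMul (tVar lKi) (w iX)
  | iF => tAdd (tAdd (tAdd (tMul (tVar lK) (w iF))
      (tMul (tmono (-1) (-3)) (tMul (tMul (tMul (tVar lF) (tVar lF)) (tVar lK)) (w iX))))
      (tMul (tCst [:: (1, 0); (1, -2)] ) (tMul FK (w iY))))
      (tMul (tmono (-1) (-1)) (tMul FK (w iL)))
  | iY => tAdd (w iY) (tMul (tmono (-1) (-1)) (tMul (tVar lF) (w iX)))
  | iL => w iL
  end.

(** RTT relations: the first matrix belongs to A, the second to B. The pair (tau_R, Delta) is the
    one that the inclusion of B in A excludes. *)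
Lemma check_DD : check_exch (Dterm lW) (Dterm lW').
Proof. by vm_compute. Qed.
Lemma check_DT : check_exch (Dterm lW) (Tterm lW').
Proof. by vm_compute. Qed.
Lemma check_TT : check_exch (Tterm lW) (Tterm lW').
Proof. by vm_compute. Qed.
(** Starting relations at max B, where the vector of B is the tuple of generators: here max A = max
    B, in [check_Dv] max B < max A. *)
Lemma check_vv : check_exch vterm vterm.
Proof. by vm_compute. Qed.
Lemma check_Dv : check_exch (Dterm lW) vterm.
Proof. by vm_compute. Qed.

(** * Soundness of the normal form computation *)

Section Soundness.
Variables (K : fieldType) (q : K) (q_neq0 : q != 0).
Variables (R : pzRingType) (iota : {rmorphism K -> R}).
Hypothesis iotaC : forall c x, iota c * x = x * iota c.

Definition monoK (c : int * int) : K := c.1%:~R * q ^ c.2.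
Definition monoR (c : int * int) : R := iota (monoK c).

Definition exch_rel (W W' : igen -> R) : Prop :=
  forall i j, W' j * W i =
    \sum_(m <- exch i j) monoR m.1 * (W m.2.1 * W' m.2.2).

Lemma monoRM c d : monoR (c.1 * d.1, c.2 + d.2) = monoR c * monoR d.
Proof.
rewrite /monoR -rmorphM /monoK /= expfzDr // intrM; congr (iota _); ring.
Qed.

Lemma monoR0 : monoR (1, 0) = 1.
Proof. by rewrite /monoR /monoK mul1r expr0z rmorph1. Qed.

Section Valuation.
Variable val : letter -> R.

Definition evw (w : seq letter) : R := foldr (fun l x => val l * x) 1 w.
Definition evp (p : seq mono) : R := \sum_(m <- p) monoR m.1 * evw m.2.

Definition rules_ok := forall l x p, rule l x = Some p -> val l * val x = evp p.

Lemma evp_cat p p' : evp (p ++ p') = evp p + evp p'.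
Proof. exact: big_cat. Qed.

Lemma evp1 w : evp [:: (1, 0, w)] = evw w.
Proof. by rewrite /evp big_seq1 monoR0 mul1r. Qed.

Lemma evp_scale c p : evp (scale c p) = monoR c * evp p.
Proof.
rewrite /evp big_map mulr_sumr; apply: eq_bigr => -[m w] _ /=.
by rewrite monoRM mulrA.
Qed.

Lemma evp_bindp (g : seq letter -> seq mono) x p :
  (forall w, evp (g w) = x * evw w) -> evp (bindp g p) = x * evp p.
Proof.
move=> gE; elim: p => [|[m w] p IH]; first by rewrite /evp !big_nil mulr0.
rewrite /bindp /= evp_cat -/(bindp g p) IH evp_scale gE.
by rewrite [in RHS]/evp big_cons /= mulrDr mulrA iotaC mulrA.
Qed.

Hypothesis rulesP : rules_ok.

(** Every exit without rewriting returns the word l w unchanged; otherwise the rule preserves the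
    value and the induction on the fuel handles each pushed letter. *)
Lemma evp_push fuel l w : evp (push fuel l w) = val l * evw w.
Proof.
elim: fuel l w => [|fuel IH] l w /=; first by rewrite evp1.
case: w => [|x w]; first by rewrite evp1.
case rE: (rule l x) => [p|]; last by rewrite evp1.
have evu u : evp (foldr (fun y => bindp (push fuel y)) [:: (1, 0, w)] u)
    = evw u * evw w.
  elim: u => [|y u IHu]; first by rewrite evp1 mul1r.
  by rewrite /= (evp_bindp _ (IH y)) IHu mulrA.
rewrite /= mulrA (rulesP rE) /bindp; elim: p {rE} => [|[m u] p IHp].
  by rewrite /evp !big_nil mul0r.
rewrite [flatten _]/= evp_cat IHp evp_scale evu.
by rewrite [in RHS]/evp big_cons /= mulrDl mulrA.
Qed.

Definition laurentR (c : laurent) : R := \sum_(x <- c) monoR x.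
Definition seval : sterm -> R := teval laurentR val.

Lemma evp_act t p : evp (act t p) = seval t * evp p.
Proof.
elim: t p => [l|c|a IHa b IHb|a IHa b IHb] p /=.
- exact: evp_bindp (evp_push 20 l).
- elim: c => [|x c IH]; first by rewrite /evp /seval /= /laurentR !big_nil mul0r.
  by rewrite /= evp_cat evp_scale IH /seval /= /laurentR big_cons mulrDl.
- by rewrite evp_cat IHa IHb mulrDl.
- by rewrite IHa IHb mulrA.
Qed.

Lemma evp_insert m p : evp (insert m p) = monoR m.1 * evw m.2 + evp p.
Proof.
elim: p => [|m' p IH] /=; first by rewrite /evp big_seq1 big_nil addr0.
case: ifP => [/andP[/eqP dE /eqP wE]|_]; last first.
  by rewrite {1}/evp big_cons -/(evp _) IH addrCA /evp big_cons.
rewrite /evp !big_cons /= addrA wE -mulrDl; congr (_ * _ + _).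
by rewrite /monoR /monoK /= dE intrD mulrDl rmorphD.
Qed.

(** Merging like monomials preserves the value, so the merged list represents the difference of t
    and u, and its zero coefficients make it vanish. *)
Lemma checkP t u : check t u -> seval t = seval u.
Proof.
move=> tu; apply/eqP; rewrite -subr_eq0; apply/eqP.
have evc p : evp (foldr insert [::] p) = evp p.
  elim: p => //= m p IH; by rewrite evp_insert IH /evp big_cons.
have := evc (act t [:: (1, 0, [::])] ++ scale (-1, 0) (act u [:: (1, 0, [::])])).
rewrite evp_cat evp_scale !evp_act evp1 /= !mulr1.
have -> : monoR (-1, 0) = -1.
  by rewrite /monoR /monoK /= expr0z mulr1 rmorphN rmorph1.
rewrite mulN1r => <-; move: tu; rewrite /check.
elim: (foldr _ _ _) => [|m p IH]; first by rewrite /evp big_nil.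
case/andP=> /eqP m0 /IH; rewrite /evp big_cons => ->.
by rewrite /monoR /monoK m0 !mul0r rmorph0 mul0r addr0.
Qed.

Lemma seval_exchT w w' i j : seval (exchT w w' i j) =
  \sum_(m <- exch i j) monoR m.1 * (seval (w m.2.1) * seval (w' m.2.2)).
Proof.
rewrite /exchT; elim: (exch i j) => [|m s IH].
  by rewrite /seval /= /laurentR !big_nil.
by rewrite big_cons -IH /seval /= /laurentR big_seq1; case: (m) => -[].
Qed.

Lemma check_exchP w w' : check_exch w w' ->
  exch_rel (fun h => seval (w h)) (fun h => seval (w' h)).
Proof.
have igensP P h : all P igens -> P h by case/and5P; case: h.
by move=> ww i j; rewrite -seval_exchT -(checkP (igensP _ j (igensP _ i ww))).
Qed.

End Valuation.
End Soundness.

(** * Transfer matrices *)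

Section Transfer.
Variables (K : fieldType) (q : K) (q_neq0 : q != 0) (q2_neq1 : q ^+ 2 != 1).
Variables (R : pzRingType) (iota : {rmorphism K -> R}).
Hypothesis iotaC : forall c x, iota c * x = x * iota c.

Let d2 : K := (q - q^-1) ^+ 2.

Lemma subqV_neq0 : q - q^-1 != 0.
Proof.
apply: contraNneq q2_neq1 => /subr0_eq qE.
by rewrite expr2 {2}qE divff.
Qed.

Lemma comm_iota c x : GRing.comm x (iota c).
Proof. by rewrite /GRing.comm iotaC. Qed.

Lemma teval_comm V (f : V -> R) (t : term K V) x :
  (forall v, GRing.comm x (f v)) -> GRing.comm x (teval iota f t).
Proof.
move=> fC; elim: t => [v|c|a IHa b IHb|a IHa b IHb] /=.
- exact: fC.
- exact: comm_iota.
- exact: commrD.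
- exact: commrM.
Qed.

Definition letter_val (u : gen -> R) (W W' : igen -> R) (l : letter) : R :=
  match l with
  | lF => u gF | lK => u gK | lKi => u gKi | lE => iota d2 * u gE
  | lW h => W h | lW' h => W' h
  end.

Record gen_rel (u : gen -> R) : Prop := GenRel {
  gen_kki : u gK * u gKi = 1;
  gen_kik : u gKi * u gK = 1;
  gen_ke : u gK * u gE = iota (q ^+ 2) * (u gE * u gK);
  gen_kf : u gK * u gF = iota (q ^- 2) * (u gF * u gK);
  gen_ef : u gE * u gF - u gF * u gE = iota (q - q^-1)^-1 * (u gK - u gKi) }.

Lemma monoR_q c d (x : K) : monoK q (c, d) = x -> monoR q iota (c, d) = iota x.
Proof. by rewrite /monoR => ->. Qed.

Lemma gen_kie u : gen_rel u -> u gE * u gKi = iota (q ^+ 2) * (u gKi * u gE).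
Proof.
move=> ur; rewrite -[u gE in LHS]mul1r -(gen_kik ur) -!mulrA.
rewrite [u gK * _]mulrA (gen_ke ur) -!mulrA (gen_kki ur) mulr1.
by rewrite [LHS]mulrA -iotaC mulrA.
Qed.

Lemma gen_ek u : gen_rel u -> u gE * u gK = iota (q ^- 2) * (u gK * u gE).
Proof.
move=> ur; rewrite (gen_ke ur) mulrA -rmorphM mulVf ?rmorph1 ?mul1r //.
by rewrite expf_neq0.
Qed.

Lemma gen_kif u : gen_rel u -> u gKi * u gF = iota (q ^+ 2) * (u gF * u gKi).
Proof.
move=> ur.
have fk : u gF * u gK = iota (q ^+ 2) * (u gK * u gF).
  by rewrite (gen_kf ur) mulrA -rmorphM mulfV ?rmorph1 ?mul1r // expf_neq0.
rewrite -[u gF in LHS]mulr1 -(gen_kki ur) [u gF * _]mulrA fk !mulrA -iotaC.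
by rewrite -!mulrA [u gKi * _]mulrA (gen_kik ur) mul1r.
Qed.

(** The rules are the relations of [gen_rel] with E rescaled, commutation across factors, and the
    assumed exchange relation. *)
Lemma letter_val_rules u W W' : gen_rel u ->
  (forall g h, GRing.comm (u g) (W h)) -> (forall g h, GRing.comm (u g) (W' h)) ->
  exch_rel q iota W W' -> rules_ok q iota (letter_val u W W').
Proof.
move=> ur uW uW' WW' l x p.
have mE c d (y : K) : c%:~R * q ^ d = y -> monoR q iota (c, d) = iota y by apply: monoR_q.
have m2 : monoR q iota (1, Posz 2) = iota (q ^+ 2) by apply: mE; rewrite mul1r.
have mN2 : monoR q iota (1, -2) = iota (q ^- 2) by apply: mE; rewrite mul1r.
(* A letter of u passes an entry of W or W'; the value of [lE] carries the central scalar d2. *)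
have swap g z : GRing.comm (u g) z ->
    z * letter_val u W W' (match g with gE => lE | gF => lF | gK => lK | gKi => lKi end)
    = letter_val u W W' (match g with gE => lE | gF => lF | gK => lK | gKi => lKi end) * z.
  by case: g => /= uz; rewrite ?uz // mulrA -iotaC -!mulrA uz.
case: l => [|||| h| h]; case: x => [|||| h'| h'] //= [<-];
  rewrite /evp ?big_cons ?big_nil ?addr0 /= ?mulr1 ?monoR0 ?mul1r;
  try by [ exact: (swap gE) | exact: (swap gF) | exact: (swap gK) | exact: (swap gKi)
         | exact: (gen_kki ur) | exact: (gen_kik ur)].
- by rewrite mN2 (gen_kf ur).
- by rewrite m2 (gen_kif ur).
(* The E F rule: d2 / (q - q^-1) = q - q^-1 is expanded into the four monomials in K and K^-1. *)
- rewrite -mulrA -[u gE * _](subrK (u gF * u gE)) (gen_ef ur) mulrDr addrC.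
  rewrite [u gF * (_ * _)]mulrA -iotaC -mulrA; congr (_ + _).
  rewrite mulrA -rmorphM [d2 / _](_ : _ = q - q^-1); last first.
    by rewrite /d2 expr2 mulfK // subqV_neq0.
  rewrite (mE 1 1 q) ?mul1r // (mE (-1) (-1) (- q^-1)) ?mulN1r //.
  rewrite (mE (-1) 1 (- q)) ?mulN1r // (mE 1 (-1) q^-1) ?mul1r //.
  by rewrite addrA -!mulrDl -!rmorphD mulrBr [- q + _]addrC -[q^-1 - q]opprB rmorphN mulNr.
- by rewrite mN2 -mulrA (gen_ek ur) mulrA -iotaC -!mulrA (mulrA (u gK)) -iotaC -mulrA.
- by rewrite m2 -mulrA (gen_kie ur) mulrA -iotaC -!mulrA (mulrA (u gKi)) -iotaC -mulrA.
- by rewrite WW' big_map; apply: eq_bigr => m _; rewrite /= mulr1.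
Qed.

Definition scaleX (W : igen -> R) (h : igen) : R :=
  if h is iX then iota d2 * W iX else W h.

(* The transfer matrix of Delta (b = true) or tau_R (b = false) applied to W.  *)
Definition step (b : bool) (u : gen -> R) (W : igen -> R) (h : igen) : R :=
  teval iota (fun l => match l with inl (_, g) => u g | inr (_, h) => W h end)
    (if b then deltaI q 0 h else tauI q 0 h).

Definition base (u : gen -> R) (h : igen) : R :=
  match h with
  | iX => u gE * u gKi
  | iF => u gF
  | iY => u gKi
  | iL => teval iota u (casimir q (fun g => tVar g))
  end.

Lemma iotaCA c x y : x * (iota c * y) = iota c * (x * y).
Proof. by rewrite mulrA -iotaC mulrA. Qed.

Section Steps.
Variables (u : gen -> R) (W W' : igen -> R).
Let sev := seval q iota (letter_val u W W').

(** Stated for arbitrary letters [w], to serve for both W and W'. *)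
Lemma seval_Dterm (w : igen -> letter) (V : igen -> R) h :
  (forall h, letter_val u W W' (w h) = scaleX V h) ->
  sev (Dterm w h) = scaleX (step true u V) h.
Proof.
move=> wV; rewrite /sev /seval /scaleX /step.
case: h; rewrite /= !wV /=.
- by rewrite mulrDr !mulrA.
- by [].
- by [].
rewrite /laurentR !big_seq1 /monoR /monoK /= !mulN1r !mul1r !expr1z.
rewrite !mulrDr !mulrA; do ?congr (_ + _).
by rewrite -[in LHS]iotaC !mulrA.
Qed.

Lemma seval_Tterm (w : igen -> letter) (V : igen -> R) h :
  (forall h, letter_val u W W' (w h) = scaleX V h) ->
  sev (Tterm w h) = scaleX (step false u V) h.
Proof.
move=> wV; rewrite /sev /seval /scaleX /step.
case: h; rewrite /= !wV /= //.
- by rewrite iotaCA.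
- rewrite /laurentR !big_seq1 /monoR /monoK /= big_cons big_seq1 /= !mulN1r !mul1r.
  rewrite -rmorphD expr0z iotaCA mulrA -rmorphM mulNr.
  by rewrite [q^-1 * _]mulrDr mulVf // -[q^-1 * q^-1]expr2 exprVn.
- rewrite /laurentR big_seq1 /monoR /monoK /= mulN1r iotaCA rmorphN1 mulN1r.
  by rewrite mulrA -rmorphM mulNr rmorphN mulNr.
Qed.

Lemma seval_vterm h : sev (vterm h) = scaleX (base u) h.
Proof.
rewrite /sev /seval; case: h; rewrite /= ?mulrA //;
by rewrite /laurentR !big_seq1 /monoR /monoK /= !mul1r expr1z.
Qed.

End Steps.

Lemma eq_exch_rel V V' W W' : V =1 W -> V' =1 W' ->
  exch_rel q iota W W' -> exch_rel q iota V V'.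
Proof.
move=> VW VW' WW' i j; rewrite VW VW' WW'; apply: eq_bigr => m _.
by rewrite VW VW'.
Qed.

(** Supplies a dummy second vector for the checks whose terms contain no W' letter. *)
Lemma exch_rel0 W : exch_rel q iota W (fun=> 0).
Proof. by move=> i j; rewrite mul0r big1 // => m _; rewrite !mulr0. Qed.

(** * Start and propagation of the exchange relation *)

Section ExchangeSteps.
Variables (u : gen -> R) (W W' : igen -> R).
Hypothesis ur : gen_rel u.
Hypothesis uW : forall g h, GRing.comm (u g) (W h).
Hypothesis uW' : forall g h, GRing.comm (u g) (W' h).

Let comm_scaleX V : (forall g h, GRing.comm (u g) (V h)) ->
  forall g h, GRing.comm (u g) (scaleX V h).
Proof. by move=> uV g [] //=; apply: commrM => //; exact: comm_iota. Qed.

Lemma exch_step (b b' : bool) : (b' -> b) ->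
  exch_rel q iota (scaleX W) (scaleX W') ->
  exch_rel q iota (scaleX (step b u W)) (scaleX (step b' u W')).
Proof.
move=> bb WW'.
have ok := letter_val_rules ur (comm_scaleX uW) (comm_scaleX uW') WW'.
case: b b' bb => [] [] bb; last 2 first.
(* tau_R for A against Delta for B: excluded by [bb]. *)
- by have := bb isT.
- apply: eq_exch_rel (check_exchP q_neq0 iotaC ok check_TT) => h; symmetry.
    exact: seval_Tterm.
  exact: seval_Tterm.
- apply: eq_exch_rel (check_exchP q_neq0 iotaC ok check_DD) => h; symmetry.
    exact: seval_Dterm.
  exact: seval_Dterm.
- apply: eq_exch_rel (check_exchP q_neq0 iotaC ok check_DT) => h; symmetry.
    exact: seval_Dterm.
  exact: seval_Tterm.
Qed.

Lemma exch_base : exch_rel q iota (scaleX (base u)) (scaleX (base u)).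
Proof.
have c0 g (h : igen) : GRing.comm (u g) 0 by rewrite /GRing.comm mulr0 mul0r.
have ok := letter_val_rules ur c0 c0 (exch_rel0 (fun=> 0)).
apply: eq_exch_rel (check_exchP q_neq0 iotaC ok check_vv) => h; symmetry;
  exact: seval_vterm.
Qed.

Lemma exch_step_base :
  exch_rel q iota (scaleX (step true u W)) (scaleX (base u)).
Proof.
have c0 g (h : igen) : GRing.comm (u g) 0 by rewrite /GRing.comm mulr0 mul0r.
have ok := letter_val_rules ur (comm_scaleX uW) c0 (exch_rel0 _).
apply: eq_exch_rel (check_exchP q_neq0 iotaC ok check_Dv) => h; symmetry.
  exact: seval_Dterm.
exact: seval_vterm.
Qed.

End ExchangeSteps.

(** * Products of transfer matrices along the factors *)

Section Chain.
Variables (n : nat) (u : nat -> gen -> R).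
Hypothesis ur : forall j, (j < n)%N -> gen_rel (u j).
Hypothesis uC : forall i j g h, (i < n)%N -> (j < n)%N -> i != j ->
  GRing.comm (u i g) (u j h).

(** The vectors W_j of the header, m standing for max A. They are continued below min A down to j =
    0, so that the chains of A and B can be compared at a common index. *)
Record chain (A : pred nat) (m : nat) (W : nat -> igen -> R) : Prop := Chain {
  chain_base : W m =1 base (u m);
  chain_step : forall j, (j < m)%N -> W j =1 step (A j) (u j) (W j.+1) }.

Fixpoint transfer (A : pred nat) (m d : nat) : igen -> R :=
  if d is d'.+1 then step (A (m - d)%N) (u (m - d)%N) (transfer A m d')
  else base (u m).

Lemma transfer_chain A m : chain A m (fun j => transfer A m (m - j)).
Proof.
split=> [h|j jm h]; first by rewrite subnn.
by rewrite -[in LHS](subnSK jm) /= subnSK // subKn // ltnW.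
Qed.

Lemma step_comm b v V x : (forall g, GRing.comm x (v g)) ->
  (forall h, GRing.comm x (V h)) -> forall h, GRing.comm x (step b v V h).
Proof. by move=> xv xV h; apply: teval_comm => -[[] _|[] _] a. Qed.

Lemma base_comm v x : (forall g, GRing.comm x (v g)) ->
  forall h, GRing.comm x (base v h).
Proof.
move=> xv [].
- exact: commrM.
- exact: xv.
- exact: xv.
- exact: (teval_comm (casimir q (fun g => tVar g)) xv).
Qed.

Lemma downward_ind (P : nat -> Prop) m :
  P m -> (forall j, (j < m)%N -> P j.+1 -> P j) -> forall j, (j <= m)%N -> P j.
Proof.
move=> Pm IH j jm; rewrite -(subKn jm).
elim: (m - j)%N (leq_subr j m) => [|d IHd] dm; first by rewrite subn0.
apply: IH; first by rewrite ltn_subLR ?addSnnS ?leq_addl // ltnW.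
by rewrite subnSK //; apply: IHd; apply: ltnW.
Qed.

(** W_j is built from the factors j, ..., m only. *)
Lemma chain_comm A m W i g : chain A m W -> (m < n)%N ->
  forall j, (j <= m)%N -> (i < j)%N -> forall h, GRing.comm (u i g) (W j h).
Proof.
move=> cW mn; apply: downward_ind => [im h|j jm IH ij h].
  rewrite (chain_base cW); apply: base_comm => g'.
  by apply: uC; rewrite ?(ltn_eqF im) //; apply: ltn_trans mn.
rewrite (chain_step cW) //; have jn := ltn_trans jm mn.
apply: step_comm => [g'|h']; last exact: IH (ltnW _) h'.
by apply: uC; rewrite ?(ltn_eqF ij) // (ltn_trans ij).
Qed.

Lemma eq_scaleX V V' : V =1 V' -> scaleX V =1 scaleX V'.
Proof. by move=> VV [] /=; rewrite ?VV. Qed.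

Lemma chain_exch (A B : pred nat) (a b : nat) (W W' : nat -> igen -> R) :
  chain A a W -> chain B b W' -> {subset B <= A} -> B b -> (b <= a)%N ->
  (a < n)%N ->
  forall j, (j <= b)%N -> exch_rel q iota (scaleX (W j)) (scaleX (W' j)).
Proof.
move=> cW cW' BA Bb ba an; have bn := leq_ltn_trans ba an.
apply: downward_ind => [|j jb IH].
  have Eb := eq_scaleX (chain_base cW').
  (* If max A = max B, both vectors are tuples of generators; otherwise A, which contains max B,
     acts there by Delta. *)
  move: ba; rewrite leq_eqVlt => /predU1P[ba|ba].
    have := eq_scaleX (chain_base cW); rewrite -ba => Ea.
    exact: eq_exch_rel Ea Eb (exch_base (ur bn)).
  have := chain_step cW ba; rewrite (BA b Bb : A b) => /eq_scaleX Ea.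
  apply: eq_exch_rel Ea Eb (exch_step_base (ur bn) _) => g h.
  exact: chain_comm cW _ _ _ _ _.
have ja := leq_trans jb ba.
apply: eq_exch_rel (eq_scaleX (chain_step cW ja)) (eq_scaleX (chain_step cW' jb)) _.
apply: exch_step => [|g h|g h||]; last exact: IH.
- exact: ur (ltn_trans jb bn).
- exact: chain_comm cW _ _ _ _ _.
- exact: chain_comm cW' _ _ _ _ _.
- exact: BA.
Qed.

Lemma chain_casimir_comm (A B : pred nat) (a b : nat) (W W' : nat -> igen -> R) :
  chain A a W -> chain B b W' -> {subset B <= A} -> B b -> (b <= a)%N ->
  (a < n)%N -> W 0 iL * W' 0 iL = W' 0 iL * W 0 iL.
Proof.
move=> cW cW' BA Bb ba an.
have := chain_exch cW cW' BA Bb ba an (leq0n b) iL iL.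
by rewrite /= big_seq1 monoR0 mul1r.
Qed.

(* tau_R fixes Lambda, so the factors on the left of min A play no role.       *)
Lemma chain_casimir_const A m W a : chain A m W -> (a <= m)%N ->
  (forall j, (j < a)%N -> ~~ A j) -> W 0 iL = W a iL.
Proof.
move=> cW am nA; suff: forall j, (j <= a)%N -> W j iL = W a iL by apply.
apply: downward_ind => // j ja <-.
by rewrite (chain_step cW) ?(leq_trans ja) // (negbTE (nA j ja)).
Qed.

Fixpoint tall (V : Type) (P : V -> Prop) (t : term K V) : Prop :=
  match t with
  | tVar v => P v
  | tCst _ => True
  | tAdd a b | tMul a b => tall P a /\ tall P b
  end.

Lemma tall_tbind V V' (P : V -> Prop) (P' : V' -> Prop) (s : V -> term K V') t :
  (forall v, P v -> tall P' (s v)) -> tall P t -> tall P' (tbind s t).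
Proof.
by move=> sP; elim: t => //= a IHa b IHb [] /IHa ? /IHb.
Qed.

Lemma tall_teval V (P : V -> Prop) (f g : V -> R) (t : term K V) :
  (forall v, P v -> f v = g v) -> tall P t -> teval iota f t = teval iota g t.
Proof.
by move=> fg; elim: t => //= a IHa b IHb [] /IHa -> /IHb ->.
Qed.

(** Invariant of the compositions: all I_R letters sit in the last factor. At the end this factor is
    max A, where the reading by [embed] agrees with W. *)
Definition lastI (p : nat) (l : mlet) : Prop :=
  if l is inr (j, _) then j = p else True.

Lemma tall_on_last phi p t : (forall h, tall (lastI p.+1) (phi p h)) ->
  tall (lastI p) t -> tall (lastI p.+1) (on_last phi p t).
Proof. by move=> phiP; apply: tall_tbind => -[[]//|[j h] /= ->]; rewrite eqxx. Qed.

Lemma tall_deltaI p h : tall (lastI p.+1) (deltaI q p h).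
Proof. by case: h => /=; do !split. Qed.

Lemma tall_tauI p h : tall (lastI p.+1) (tauI q p h).
Proof. by case: h => /=; do !split. Qed.

Lemma tall_taus k p t : tall (lastI p) t -> tall (lastI (p + k)) (taus q k p t).
Proof.
elim: k p t => [|k IH] p t /=; first by rewrite addn0.
by move=> pt; rewrite addnS -addSn; apply/IH/tall_on_last/pt/tall_tauI.
Qed.

(** * Lambda_A as an entry of the transfer product *)

Section Composition.
Variables (a1 : nat) (W : nat -> igen -> R).

Definition mlet_val (V : nat -> igen -> R) (l : mlet) : R :=
  match l with
  | inl (j, g) => u (a1 + j)%N g
  | inr (j, h) => V (a1 + j)%N h
  end.

(** When I_R letters are read as entries of W, substituting [deltaI] or [tauI] for them merely
    unfolds the recursion that defines W. *)
Lemma teval_on_last (b : bool) p t :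
  W (a1 + p)%N =1 step b (u (a1 + p)%N) (W (a1 + p).+1) ->
  teval iota (mlet_val W) (on_last (if b then deltaI q else tauI q) p t) =
  teval iota (mlet_val W) t.
Proof.
move=> Wp; rewrite teval_tbind; apply: eq_teval => -[[j g]|[j h]] //=.
case: eqP => // ->; rewrite Wp /step.
by case: b {Wp}; case: h; rewrite /= ?addnS.
Qed.

Lemma teval_taus k p t :
  (forall i, (i < k)%N ->
    W (a1 + (p + i))%N =1 step false (u (a1 + (p + i))%N) (W (a1 + (p + i)).+1)) ->
  teval iota (mlet_val W) (taus q k p t) = teval iota (mlet_val W) t.
Proof.
elim: k p t => [|k IH] p t Wp //=.
rewrite IH => [|i ik]; last by rewrite addSnnS; apply: Wp.
by apply: (@teval_on_last false); have := Wp 0 isT; rewrite addn0.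
Qed.

(** The maps are undone one at a time, none changing the value read in W; passing from the
    generators read by [embed] to W occurs once, when rest = [::]. *)
Lemma teval_mus (A : pred nat) m rest p prev t :
  chain A m W -> prev = (a1 + p)%N -> path ltn prev rest -> last prev rest = m ->
  (forall j, (prev <= j)%N -> A j = (j \in prev :: rest)) ->
  tall (lastI p) t ->
  teval iota (mlet_val (fun j => base (u j))) (mus q p prev rest t) =
  teval iota (mlet_val W) t.
Proof.
clear q_neq0 q2_neq1; move=> cW; elim: rest p prev t => [|a rest IH] p prev t prevE /=.
  move=> _ mE _ pt; apply: tall_teval pt => -[[]//|[j h] /= ->].
  by rewrite -prevE mE (chain_base cW).
case/andP=> pa ar mE AE pt.
have aall := order_path_min ltn_trans ar.
have am : (a <= m)%N.
  by rewrite -mE; have := mem_last a rest; rewrite inE => /predU1P[->//|/(allP aall)/ltnW].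
rewrite {}IH //; first 1 last.
- by lia.
- move=> j aj; rewrite AE; last exact: leq_trans (ltnW pa) aj.
  by rewrite inE gtn_eqF // (leq_trans pa).
- have -> : (p + (a - prev) = p.+1 + (a - prev - 1))%N by lia.
  exact/tall_taus/tall_on_last/pt/tall_deltaI.
rewrite teval_taus => [|i ik].
  apply: (@teval_on_last true); rewrite -prevE => h.
  by rewrite (chain_step cW) ?(leq_trans pa) // AE // mem_head.
(* Factors strictly between prev and a lie outside A, so the chain uses tau_R there. *)
have ja : (a1 + (p.+1 + i) < a)%N by lia.
move=> h; rewrite (chain_step cW) ?(leq_trans ja) // AE; last by lia.
rewrite !inE gtn_eqF ?ltn_eqF //=; last by lia.
case: (boolP (_ \in _)) => // /(allP aall) /= /(ltn_trans ja).
by rewrite ltnn.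
Qed.

End Composition.
End Chain.
End Transfer.

(** * Return to the presented algebra *)

Section Conclusion.
Variables (K : fieldType) (q : K) (q_neq0 : q != 0) (q2_neq1 : q ^+ 2 != 1).
Variable n : nat.

Let U := Uq q n.
Let iota : {rmorphism K -> U} := Uq_cst q n.

Definition Uq_gen (j : nat) (g : gen) : U := \pi_U (uvar K n j g).

Lemma pi_teval t : \pi_U t = teval iota (fun v => \pi_U (tVar v)) t.
Proof.
by elim: t => //= a IHa b IHb; rewrite -IHa -IHb ?pi_add ?pi_mul.
Qed.

Lemma uvarE (j : nat) (jn : (j < n)%N) g : uvar K n j g = tVar (Ordinal jn, g) :> term K _.
Proof. by rewrite /uvar insubT. Qed.

Lemma Uq_gen_rel j : (j < n)%N -> gen_rel q iota (Uq_gen j).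
Proof.
move=> jn; rewrite /Uq_gen.
have rel t u : ueq q t u -> teval iota (fun v => \pi_U (tVar v)) t =
    teval iota (fun v => \pi_U (tVar v)) u by move/piP; rewrite !pi_teval.
split; rewrite !(uvarE jn).
- by have := rel _ _ (ueq_KKi q (Ordinal jn)); rewrite /= rmorph1.
- by have := rel _ _ (ueq_KiK q (Ordinal jn)); rewrite /= rmorph1.
- exact: (rel _ _ (ueq_KE q (Ordinal jn))).
- exact: (rel _ _ (ueq_KF q (Ordinal jn))).
- by have := rel _ _ (ueq_EF q (Ordinal jn)); rewrite /= rmorphN1 !mulN1r.
Qed.

Lemma Uq_gen_comm i j g h : (i < n)%N -> (j < n)%N -> i != j ->
  GRing.comm (Uq_gen i g) (Uq_gen j h).
Proof.
move=> im jn ij; rewrite /GRing.comm /Uq_gen (uvarE im) (uvarE jn).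
by rewrite -[LHS]pi_mul -[RHS]pi_mul; apply/piP; apply: ueq_comm.
Qed.

Lemma pi_embed a1 t : \pi_U (embed q n a1 t) =
  teval iota (mlet_val Uq_gen a1 (fun j => base q iota (Uq_gen j))) t.
Proof.
rewrite pi_teval teval_tbind; apply: eq_teval => -[[j g]|[j h]] /=.
  by rewrite -pi_teval.
by case: h; rewrite /= /Uq_gen ?pi_teval.
Qed.

Lemma pi_LambdaA (A : {set 'I_n}) a1 rest :
  sort leq [seq nat_of_ord i | i <- enum A] = a1 :: rest ->
  let m := last a1 rest in
  exists W, chain q iota Uq_gen (mem (a1 :: rest)) m W /\
            \pi_U (LambdaA q A) = W 0 iL.
Proof.
move=> sE m; have cW := transfer_chain q iota Uq_gen (mem (a1 :: rest)) m.
exists (fun j => transfer q iota Uq_gen (mem (a1 :: rest)) m (m - j)); split=> //.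
have ltA : sorted ltn (a1 :: rest).
  rewrite -sE ltn_sorted_uniq_leq sort_uniq map_inj_uniq ?enum_uniq; last exact: val_inj.
  exact: sort_sorted leq_total _.
have a1m : (a1 <= m)%N.
  rewrite /m; have := mem_last a1 rest; rewrite inE => /predU1P[->//|].
  by move/(allP (order_path_min ltn_trans ltA))/ltnW.
rewrite /LambdaA sE pi_embed.
rewrite (teval_mus cW) ?addn0 //= ?addn0 //.
(* [teval_mus] gives the Lambda-entry at min A; tau_R carries it unchanged to index 0. *)
symmetry; apply: (chain_casimir_const cW a1m) => j ja /=.
rewrite !inE ltn_eqF //=; apply/negP.
by move/(allP (order_path_min ltn_trans ltA))/(ltn_trans ja); rewrite ltnn.
Qed.

End Conclusion.

Lemma path_leq_last a r x : path leq a r -> x \in a :: r -> (x <= last a r)%N.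
Proof.
elim: r a x => [|c r IH] a x /=; first by rewrite inE => _ /eqP->.
case/andP=> ac cr; rewrite inE => /predU1P[->|]; last exact: IH.
by apply: leq_trans ac _; apply: IH cr (mem_head _ _).
Qed.

Theorem theorem3p1 (K : fieldType) (q : K)
  (q_neq0 : q != 0) (q_not_root : forall m : nat, (0 < m)%N -> q ^+ m != 1)
  (n : nat) (n_ge1 : (1 <= n)%N) (A B : {set 'I_n}) (BsubA : B \subset A) :
  ueq q (tMul (LambdaA q A) (LambdaA q B)) (tMul (LambdaA q B) (LambdaA q A)).
Proof.
have q2_neq1 := q_not_root 2 isT.
apply/piP; rewrite !pi_mul -[LHS]/(_ * _ : Uq q n) -[RHS]/(_ * _ : Uq q n).
pose s (C : {set 'I_n}) := sort leq [seq nat_of_ord i | i <- enum C].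
have sE (C : {set 'I_n}) j : (j \in s C) = (j \in [seq nat_of_ord i | i <- enum C]).
  exact: mem_sort.
have sBA : {subset s B <= s A}.
  move=> j; rewrite !sE => /mapP[i iB ->]; apply: map_f.
  by move: iB; rewrite !mem_enum; apply: (subsetP BsubA).
have sn (C : {set 'I_n}) j : j \in s C -> (j < n)%N by rewrite sE => /mapP[i _ ->].
(* For an empty A or B, the element is the scalar q + q^-1, which is central. *)
case EA: (s A) => [|a restA].
  by rewrite [X in \pi_(_) X]/LambdaA -/(s A) EA; apply: Uq_cstC.
case EB: (s B) => [|b restB].
  by rewrite [LambdaA q B]/LambdaA -/(s B) EB; apply/esym/Uq_cstC.
have [W [cW ->]] := pi_LambdaA q EA.
have [W' [cW' ->]] := pi_LambdaA q EB.
apply: (chain_casimir_comm q_neq0 q2_neq1 (@Uq_cstC K q n) _ _ cW cW').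
- exact: Uq_gen_rel.
- exact: Uq_gen_comm.
- by move=> j /=; rewrite -!topredE /= -EA -EB; apply: sBA.
- exact: mem_last.
- apply: path_leq_last; last by rewrite -EA sBA // EB mem_last.
  by have := sort_sorted leq_total [seq nat_of_ord i | i <- enum A]; rewrite -/(s A) EA.
- by apply: (sn A); rewrite EA mem_last.
Qed.
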